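(* Let $X$ be a real Banach space and let $\kappa$ be an uncountable cardinal. Then: (1) Assume that for every Banach space $Y$ with $\operatorname{dens}(Y)<\kappa$, every subset $G\subseteq X$ of cardinality smaller than $\kappa$ and every $\varepsilon>0$ there exists a bounded linear operator $\phi:Y\longrightarrow X$ such that $$\Vert z+\phi(y)\Vert\geq (1-\varepsilon)(\Vert z\Vert+\Vert y\Vert)$$ holds for every $y\in Y$ and $z\in G$. Then $L(Y,X)$ is $\kappa$-octahedral for every Banach space $Y$ with $\operatorname{dens}(Y)<\kappa$. (2) Assume that for every Banach space $Y$ with $\operatorname{dens}(Y)<\kappa$ and every subset $G\subseteq X$ of cardinality smaller than $\kappa$ there exists a bounded linear operator $\phi:Y\longrightarrow X$ such that $$\Vert z+\phi(y)\Vert=\Vert z\Vert+\Vert y\Vert$$ holds for every $y\in Y$ and $z\in G$. Then $L(Y,X)$ is $\kappa$-rigid octahedral for every Banach space $Y$ with $\operatorname{dens}(Y)<\kappa$.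
   Context: Banach spaces are real. $L(Y,X)$ is the space of bounded linear operators from $Y$ to $X$ with the operator norm. $S_E$ denotes the unit sphere of a Banach space $E$. $\operatorname{dens}(E)$ is the least cardinality of a subset of $E$ whose linear span is dense in $E$ (so $\operatorname{dens}(E)=\dim E$ if $E$ is finite-dimensional). For an infinite cardinal $\kappa$, a Banach space $E$ is $\kappa$-octahedral if for every cardinal $\kappa'<\kappa$, every collection $\{x_\alpha:\alpha<\kappa'\}\subseteq S_E$ and every $\varepsilon>0$ there exists $x\in S_E$ such that $\Vert x_\alpha+x\Vert\geq 2-\varepsilon$ for all $\alpha<\kappa'$. It is $\kappa$-rigid octahedral if this holds with $\varepsilon=0$, i.e. for every such collection there is $x\in S_E$ with $\Vert x_\alpha+x\Vert=2$ for all $\alpha<\kappa'$.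
   Formalization: In (1) the operators φ are also required to satisfy ‖φ‖ ≤ 1, without which (1) fails (ℓ²-sum of ω₁ copies of ℓ^∞, κ=ℵ₁, Y=ℝ); in both conclusions Y is assumed nonzero, since L({0},X) has empty unit sphere. *)

(* Defs.v *)
From HB Require Import structures.
From mathcomp Require Import all_boot all_order all_algebra.
From mathcomp Require Import all_classical all_reals.
From mathcomp Require Import topology normedtype.

Set Implicit Arguments.
Unset Strict Implicit.
Unset Printing Implicit Defensive.

Import Order.TTheory GRing.Theory Num.Theory.
Import numFieldNormedType.Exports.

Local Open Scope classical_set_scope.
Local Open Scope card_scope.
Local Open Scope ring_scope.

Definition bounded_linear (R : realType) (Y X : normedModType R) :
    {pred Y -> X} :=
  fun f => `[< linear f /\ exists M : R, forall y, `|f y| <= M * `|y| >].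

Section BoundedOp.
Context {R : realType} {Y X : normedModType R}.

Lemma bounded_linear_submod_closed : submod_closed (@bounded_linear R Y X).
Proof.
split.
  apply/asboolP; split; first by move=> a u v /=; rewrite scaler0 addr0.
  by exists 0 => y; rewrite normr0 mul0r.
move=> a f g /asboolP[lf [M fM]] /asboolP[lg [N gN]]; apply/asboolP; split.
  move=> b u v; rewrite !fctE lf lg !scalerDr !scalerA (mulrC a b).
  by rewrite addrACA.
exists (`|a| * M + N) => y; rewrite !fctE (le_trans (ler_normD _ _))//.
by rewrite mulrDl lerD// normrZ -mulrA ler_wpM2l.
Qed.

HB.instance Definition _ := GRing.isSubmodClosed.Build R (Y -> X)
  (@bounded_linear R Y X) bounded_linear_submod_closed.

End BoundedOp.

Record bounded_op (R : realType) (Y X : normedModType R) := BoundedOp {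
  bounded_op_fun :> Y -> X;
  bounded_op_prop : bounded_op_fun \in @bounded_linear R Y X }.

Section BoundedOpTheory.
Context {R : realType} {Y X : normedModType R}.

HB.instance Definition _ := [isSub for @bounded_op_fun R Y X].
HB.instance Definition _ := [Choice of bounded_op Y X by <:].
HB.instance Definition _ :=
  [SubChoice_isSubLmodule of bounded_op Y X by <:].

Implicit Types f g : bounded_op Y X.

Lemma bounded_op_linear f : linear f.
Proof. by have /asboolP[] := bounded_op_prop f. Qed.

Lemma bounded_op_bounded f : exists M : R, forall y, `|f y| <= M * `|y|.
Proof. by have /asboolP[] := bounded_op_prop f. Qed.

HB.instance Definition _ f :=
  GRing.isLinear.Build R Y X *:%R (bounded_op_fun f) (bounded_op_linear f).

Lemma bounded_opP f g : f =1 g -> f = g.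
Proof. by move=> fg; apply/val_inj/funext. Qed.

Lemma bounded_opD f g y : (f + g) y = f y + g y. Proof. by []. Qed.

Lemma bounded_opZ (a : R) f y : (a *: f) y = a *: f y. Proof. by []. Qed.

Lemma bounded_op0 y : (0 : bounded_op Y X) y = 0. Proof. by []. Qed.

Lemma bounded_opN f y : (- f) y = - f y. Proof. by []. Qed.

Definition opnorm f : R := sup [set `|f y| | y in [set y : Y | `|y| <= 1]].

Lemma opnorm_has_sup f : has_sup [set `|f y| | y in [set y : Y | `|y| <= 1]].
Proof.
split; first by exists `|f 0|, 0 => //=; rewrite normr0.
have [M fM] := bounded_op_bounded f.
exists `|M| => _ [y /= y1 <-]; rewrite (le_trans (fM y))//.
rewrite (le_trans (ler_wpM2r _ (ler_norm M)))//.
by rewrite ler_piMr.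
Qed.

Lemma opnorm_ub f y : `|y| <= 1 -> `|f y| <= opnorm f.
Proof.
by move=> y1; apply: sup_upper_bound; [exact: opnorm_has_sup|exists y].
Qed.

Lemma opnorm_le f (M : R) :
  (forall y, `|y| <= 1 -> `|f y| <= M) -> opnorm f <= M.
Proof.
move=> fM; apply: ge_sup; first by have [] := opnorm_has_sup f.
by move=> _ [y /= y1 <-]; exact: fM.
Qed.

Lemma opnorm_ge0 f : 0 <= opnorm f.
Proof. by apply: le_trans (@opnorm_ub f 0 _); rewrite ?normr0. Qed.

Lemma opnormP f y : `|f y| <= opnorm f * `|y|.
Proof.
have [->|y0] := eqVneq y 0; first by rewrite raddf0 !normr0 mulr0.
have ny0 : 0 < `|y| by rewrite normr_gt0.
rewrite -ler_pdivrMr//.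
have := @opnorm_ub f (`|y|^-1 *: y).
rewrite linearZ/= !normrZ normfV normr_id mulVf ?normr_eq0// => /(_ (lexx _)).
by rewrite mulrC.
Qed.

Lemma opnorm_leP f (M : R) :
  0 <= M -> (forall y, `|f y| <= M * `|y|) -> opnorm f <= M.
Proof.
move=> M0 fM; apply: opnorm_le => y y1; rewrite (le_trans (fM y))//.
by rewrite ler_piMr.
Qed.

Lemma ler_opnormD f g : opnorm (f + g) <= opnorm f + opnorm g.
Proof.
apply: opnorm_le => y y1; rewrite bounded_opD (le_trans (ler_normD _ _))//.
by rewrite lerD// opnorm_ub.
Qed.

Lemma opnormZ (a : R) f : opnorm (a *: f) = `|a| * opnorm f.
Proof.
have le_opnormZ (b : R) g : opnorm (b *: g) <= `|b| * opnorm g.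
  by apply: opnorm_le => y y1; rewrite bounded_opZ normrZ ler_wpM2l// opnorm_ub.
have [->|a0] := eqVneq a 0.
  rewrite scale0r normr0 mul0r; apply/eqP; rewrite eq_le opnorm_ge0 andbT.
  by apply: opnorm_le => y _; rewrite bounded_op0 normr0.
apply/eqP; rewrite eq_le le_opnormZ/= -ler_pdivlMl ?normr_gt0//.
by rewrite -normfV -[X in opnorm X <= _](scalerK a0) le_opnormZ.
Qed.

Lemma opnorm_eq0 f : opnorm f = 0 -> f = 0.
Proof.
move=> f0; apply: bounded_opP => y; apply/eqP; rewrite bounded_op0 -normr_le0.
by rewrite (le_trans (opnormP f y))// f0 mul0r.
Qed.

HB.instance Definition _ := Lmodule_isNormed.Build R (bounded_op Y X)
  ler_opnormD opnormZ opnorm_eq0.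

Lemma bounded_op_normE f : `|f| = opnorm f. Proof. by []. Qed.

Lemma bounded_op_le f y : `|f y| <= `|f| * `|y|. Proof. exact: opnormP. Qed.

End BoundedOpTheory.

Section BoundedOpComplete.
Context {R : realType} {Y : normedModType R} {X : completeNormedModType R}.

Lemma bounded_op_complete (F : set_system (bounded_op Y X)) :
  ProperFilter F -> cauchy F -> cvg F.
Proof.
move=> FF /cauchyP Fc.
have Fcb (e : R) : 0 < e -> exists f, \forall g \near F, `|f - g| < e.
  move=> e0; have [f Ff] := Fc e e0.
  by exists f; move: Ff; rewrite -ball_normE.
have Fcvg (y : Y) : cvg ((fun f : bounded_op Y X => f y) @ F).
  apply: cauchy_cvg; apply/cauchyP => e e0.
  have d0 : 0 < e / (`|y| + 1) by rewrite divr_gt0// ltr_wpDl.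
  have [f Ff] := Fcb _ d0; exists (f y); rewrite -ball_normE /=.
  apply: filterS Ff => g fg; rewrite /ball_ /= -bounded_opN -bounded_opD.
  rewrite (le_lt_trans (bounded_op_le _ _))//.
  rewrite (@le_lt_trans _ _ (`|f - g| * (`|y| + 1)))//.
    by rewrite ler_wpM2l// lerDl.
  by rewrite -ltr_pdivlMr// ltr_wpDl.
pose h (y : Y) : X := lim ((fun f : bounded_op Y X => f y) @ F).
have hcvg y : f y @[f --> F] --> h y by exact: Fcvg.
have hdist (e : R) f y : (\forall g \near F, `|f - g| < e) ->
    `|f y - h y| <= e * `|y|.
  move=> Ff; have cv : `|f y - g y| @[g --> F] --> `|f y - h y|.
    by apply: cvg_norm; apply: cvgB; [exact: cvg_cst|exact: hcvg].
  rewrite -(cvg_lim _ cv)//; apply: limr_le; first exact: cvgP cv.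
  apply: filterS Ff => g fg; rewrite -bounded_opN -bounded_opD.
  by rewrite (le_trans (bounded_op_le _ _))// ler_wpM2r// ltW.
have hbl : h \in @bounded_linear R Y X.
  apply/asboolP; split.
    move=> a u v.
    have cv : a *: f u + f v @[f --> F] --> a *: h u + h v.
      by apply: cvgD; [apply: cvgZr; exact: hcvg|exact: hcvg].
    rewrite -(cvg_lim _ cv)// /h; congr (lim (_ @ F)).
    by apply/funext => f; rewrite bounded_op_linear.
  have [f Ff] := Fcb 1 ltr01; exists (`|f| + 1) => y.
  rewrite -[h y](subKr (f y)) (le_trans (ler_normB _ _))// mulrDl lerD//.
    exact: bounded_op_le.
  exact: hdist.
apply/cvg_ex; exists (BoundedOp hbl); apply/cvgrPdist_le => e e0.
have e20 : 0 < e / 2 by rewrite divr_gt0.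
have [f Ff] := Fcb _ e20.
near=> g; have fg : `|f - g| < e / 2 by near: g.
rewrite -[_ - g](subrKA f) (le_trans (ler_normD _ _))// (splitr e) lerD//.
  apply: opnorm_leP; first exact: ltW.
  by move=> y; rewrite bounded_opD bounded_opN /= distrC hdist.
exact: ltW.
Unshelve. all: by end_near. Qed.

HB.instance Definition _ :=
  Uniform_isComplete.Build (bounded_op Y X) bounded_op_complete.

End BoundedOpComplete.

Definition card_lt T U (A : set T) (B : set U) : Prop :=
  A #<= B /\ ~ (B #<= A).

Definition linear_span (R : realType) (E : normedModType R) (D : set E) :
    set E :=
  [set x | exists (n : nat) (a : 'I_n -> R) (d : 'I_n -> E),
     (forall i, D (d i)) /\ x = \sum_(i < n) a i *: d i].

(* The cardinality of D is dens(E). *)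
Definition is_dens (R : realType) (E : normedModType R) (D : set E) : Prop :=
  dense (linear_span D) /\
  forall D' : set E, dense (linear_span D') -> D #<= D'.

(* A cardinal kappa is given by a type K of that cardinality. *)
Definition dens_lt (R : realType) (E : normedModType R) (K : Type) : Prop :=
  exists D : set E, is_dens D /\ card_lt D [set: K].

Definition unit_sphere (R : realType) (E : normedModType R) : set E :=
  [set x | `|x| = 1].

Definition octahedral (R : realType) (K : Type)
    (E : completeNormedModType R) : Prop :=
  forall I : Type, card_lt [set: I] [set: K] ->
  forall x : I -> E, (forall i, unit_sphere (x i)) ->
  forall e : R, 0 < e ->
  exists u : E, unit_sphere u /\ forall i, 2 - e <= `|x i + u|.

Definition rigid_octahedral (R : realType) (K : Type)
    (E : completeNormedModType R) : Prop :=
  forall I : Type, card_lt [set: I] [set: K] ->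
  forall x : I -> E, (forall i, unit_sphere (x i)) ->
  exists u : E, unit_sphere u /\ forall i, `|x i + u| = 2.

(* Main.v *)
(* Given unit operators T_i, choose y_i (y_(i,n) in the rigid case) in the unit
   ball of Y at which T_i almost attains its norm. As kappa is uncountable, the
   set G of the vectors T_i y_i has fewer than kappa elements, so the hypothesis
   applies to Y itself and G, and the operator phi it yields makes
   |T_i y_i + phi y_i|, hence |T_i + phi|, close to 2. Adding 0 to G bounds
   |phi| from below, so phi can be normalized (it is isometric in the rigid
   case). *)
Require Import Defs.
From HB Require Import structures.
From mathcomp Require Import all_boot all_order all_algebra.
From mathcomp Require Import all_classical all_reals.
From mathcomp Require Import topology normedtype.
From mathcomp Require Import lra.

Set Implicit Arguments.
Unset Strict Implicit.
Unset Printing Implicit Defensive.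

Import Order.TTheory GRing.Theory Num.Theory.
Import numFieldNormedType.Exports.

Local Open Scope classical_set_scope.
Local Open Scope card_scope.
Local Open Scope ring_scope.

Lemma countableU (T : Type) (A B : set T) :
  countable A -> countable B -> countable (A `|` B).
Proof.
move=> Ac Bc; rewrite -bigcup2E; apply: bigcup_countable => // n _.
by case: n => [|[|n]].
Qed.

(* A maximal disjoint family of injective sequences covers all but finitely many
   points of I; the exceptional points are absorbed into one of the ranges, and
   splitting the index set nat of every sequence absorbs the factor nat. *)
Lemma card_setX_nat_infinite (I : Type) :
  infinite_set [set: I] -> [set: I * nat] #<= [set: I].
Proof.
elim/Ppointed: I => I Iinf; first by case: Iinf; rewrite empty_eq0.
have [E [Einj Edisj Emax]] := ex_maximal_disjoint_subcollection
  (fun g : nat -> I => range g) [set g : nat -> I | injective g].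
pose U := \bigcup_(g in E) range g.
have CUfin : finite_set (~` U).
  apply: contrapT => /infiniteP/pcard_leP/injfunPex[h hU hI].
  have hE : ~ E h by move=> Eh; apply: (hU 0%N) => //; exists h.
  apply: (Emax (E `|` [set h])).
  - by split=> [g Eg|sub]; [left|apply: hE; apply: sub; right].
  - by move=> g [/Einj//|->] m n; apply: hI; rewrite inE.
  - move=> f g [Ef|->] [Eg|->] //.
    + exact: Edisj.
    + by move=> [i [[m _ <-] [n _ hn]]]; case: (hU n) => //; rewrite hn; exists f.
    + by move=> [i [[m _ <-] [n _ hn]]]; case: (hU m) => //; rewrite -hn; exists g.
have [g0 Eg0] : E !=set0.
  apply: contrapT => E0; apply: Iinf; apply: sub_finite_set CUfin.
  by move=> i _ [g Eg _]; apply: E0; exists g.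
have [e rge] : exists e : nat -> I, set_surj [set: nat] (range g0 `|` ~` U) e.
  apply/pcard_surjP/countableU; last exact: finite_set_countable.
  exact: card_image_le.
(* Each [i] is coded by a sequence of [E] and an index; [g0] is read through [e], so that it also
   codes the points outside [U]. *)
have /choice[s sP] : forall i, exists p : (nat -> I) * nat,
    E p.1 /\ i = (if `[< p.1 = g0 >] then e p.2 else p.1 p.2).
  move=> i; have [[g Eg [n _ gn]]|CUi] := pselect (U i); last first.
    by have [|n _ <-] := rge i; [right|exists (g0, n); rewrite asboolT].
  have [gg0|gg0] := pselect (g = g0); last by exists (g, n); rewrite asboolF.
  have [|m _ <-] := rge i; first by left; exists n; rewrite -?gg0.
  by exists (g0, m); rewrite asboolT.
(* Disjointness of the ranges recovers the sequence, its injectivity the paired indices. *)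
apply/pcard_injP; exists (fun p => (s p.1).1 (pickle ((s p.1).2, p.2))).
move=> [i m] [j n] _ _ /= ij.
have gij : (s i).1 = (s j).1.
  apply: Edisj; [exact: (sP i).1|exact: (sP j).1|].
  by exists ((s i).1 (pickle ((s i).2, m))); split; [|rewrite ij]; eexists.
move: ij; rewrite gij => /(Einj _ (sP j).1)/(pcan_inj pickleK)[nij ->].
by congr pair; rewrite (sP i).2 (sP j).2 gij nij.
Qed.

(** For finite [I] the union is countable, hence strictly below the uncountable [K]. For infinite
    [I], enumerating [C] together with [A i] for each [i] bounds the union by [I * nat], hence by
    [I]. *)
Lemma card_lt_countable_bigcup (I T K : Type) (A : I -> set T) (C : set T) :
  ~ countable [set: K] -> card_lt [set: I] [set: K] ->
  countable C -> (forall i, countable (A i)) ->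
  card_lt (C `|` \bigcup_i A i) [set: K].
Proof.
move=> Kunc [IK KI] Cc Ac.
have [Ifin|Iinf] := pselect (finite_set [set: I]).
  have G : countable (C `|` \bigcup_i A i).
    by apply: countableU => //; apply: bigcup_countable => //;
       exact: finite_set_countable.
  split; last by move=> KG; apply: Kunc; exact: sub_countable G.
  apply: (card_le_trans G); apply/infiniteP => Kfin.
  by apply: Kunc; exact: finite_set_countable.
suff G : C `|` \bigcup_i A i #<= [set: I].
  split; first exact: card_le_trans G IK.
  by move=> KG; apply: KI; exact: card_le_trans KG G.
apply: card_le_trans (card_setX_nat_infinite Iinf).
elim/Ppointed: T => T in A C Cc Ac *; first by rewrite empty_eq0.
have /choice[e eP] : forall i, exists e : nat -> T,
    set_surj [set: nat] (C `|` A i) e.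
  by move=> i; apply/pcard_surjP/countableU.
apply/pcard_surjP; exists (fun p => e p.1 p.2) => x [Cx|[i _ Aix]].
  have [i _] := infinite_setN0 Iinf.
  by have [|n _ <-] := eP i x; [left|exists (i, n)].
by have [|n _ <-] := eP i x; [right|exists (i, n)].
Qed.

Lemma bounded_op_norming (R : realType) (Y X : normedModType R)
    (f : bounded_op Y X) (e : R) : 0 < e ->
  exists y : Y, `|y| <= 1 /\ `|f| - e < `|f y|.
Proof.
move=> e0; have [_ [y /= y1 <-] fy] := sup_adherent e0 (opnorm_has_sup f).
by exists y.
Qed.

Lemma norm_normalize_dist (R : realType) (V : normedModType R) (v : V) : v != 0 ->
  `|v - `|v|^-1 *: v| = `| `|v| - 1 |.
Proof.
move=> v0; rewrite -[X in X - _]scale1r -scalerBl normrZ -[X in _ * X]normr_id.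
by rewrite -normrM mulrBl mul1r mulVf ?normr_eq0.
Qed.

Section BoundedOpEstimates.
Context {R : realType} {X Y : normedModType R}.
Implicit Types (f phi : bounded_op Y X) (y : Y).

(** Since [f] has norm 1, [a] bounds not only the norm of [f y] but also that of [y] from below. *)
Lemma bounded_opD_lower_bound f phi (c a : R) y :
  `|f| = 1 -> `|y| <= 1 -> 0 <= c -> a <= `|f y| ->
  c * (`|f y| + `|y|) <= `|f y + phi y| -> c * (2 * a) <= `|f + phi|.
Proof.
move=> f1 y1 c0 afy le; apply: le_trans (_ : `|(f + phi) y| <= _); last first.
  by rewrite (le_trans (bounded_op_le _ _))// ler_piMr.
apply: le_trans le; rewrite ler_wpM2l// mulr_natl mulr2n lerD//.
by rewrite (le_trans afy)// (le_trans (bounded_op_le f y))// f1 mul1r.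
Qed.

Lemma bounded_op_norm_ge phi (c : R) :
  (exists y, y != 0) -> (forall y, c * `|y| <= `|phi y|) -> c <= `|phi|.
Proof.
move=> [y y0] cphi; have ny : 0 < `|y| by rewrite normr_gt0.
by rewrite -(ler_pM2r ny) (le_trans (cphi y))// bounded_op_le.
Qed.

End BoundedOpEstimates.

(* The bound `|phi| <= 1 in the first part cannot be dropped: if X is the l^2-sum
   of uncountably many copies of l^oo, M times an embedding into an unused
   coordinate satisfies the inequality for M large, but X = L(R, X) is not
   octahedral. In the second part phi is automatically isometric. The operator
   space must be nonzero, since the unit sphere of L(0, X) is empty. *)
Theorem theorem3p4 (R : realType) (X : completeNormedModType R) (K : Type)
    (hK : ~ countable [set: K]) :
  ((forall Y : completeNormedModType R, dens_lt Y K ->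
    forall G : set X, card_lt G [set: K] ->
    forall e : R, 0 < e ->
    exists phi : bounded_op Y X, `|phi| <= 1 /\
      forall (y : Y) (z : X), G z ->
        (1 - e) * (`|z| + `|y|) <= `|z + phi y|) ->
   forall Y : completeNormedModType R, dens_lt Y K -> (exists y : Y, y != 0) ->
     octahedral K (bounded_op Y X))
  /\
  ((forall Y : completeNormedModType R, dens_lt Y K ->
    forall G : set X, card_lt G [set: K] ->
    exists phi : bounded_op Y X,
      forall (y : Y) (z : X), G z ->
        `|z + phi y| = `|z| + `|y|) ->
   forall Y : completeNormedModType R, dens_lt Y K -> (exists y : Y, y != 0) ->
     rigid_octahedral K (bounded_op Y X)).
Proof.
split=> HX Y YK Y0 I IK T T1.
  (* The estimate 2(1 - d)^2 >= 2 - 4d loses 4d and normalizing [phi] loses another d; d <= 1/2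
     keeps [phi] nonzero. *)
  move=> e e0; pose d := Num.min (e / 5) 2^-1.
  have d0 : 0 < d by rewrite lt_min; apply/andP; split; lra.
  have de : d * 5 <= e by rewrite -ler_pdivlMr// ge_min lexx.
  have d1 : d <= 2^-1 by rewrite ge_min lexx orbT.
  have [y yP] := choice (fun i => bounded_op_norming (T i) d0).
  have [] := HX Y YK ([set 0] `|` \bigcup_i [set T i (y i)]) _ d d0.
    exact: card_lt_countable_bigcup.
  move=> phi [phi1 phiP].
  have phid : 1 - d <= `|phi|.
    apply: bounded_op_norm_ge => // z.
    by have := phiP z 0 (or_introl erefl); rewrite normr0 !add0r.
  have phi0 : phi != 0 by rewrite -normr_gt0; lra.
  exists (`|phi|^-1 *: phi); split.
    by rewrite /unit_sphere /= normrZ normfV normr_id mulVf ?normr_eq0.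
  move=> i; have [y1 Ty] := yP i; rewrite (T1 i) in Ty.
  have Tphi : (1 - d) * (2 * (1 - d)) <= `|T i + phi|.
    apply: (bounded_opD_lower_bound (T1 i) y1); [lra|exact: ltW|].
    by apply: phiP; right; exists i.
  have dist := norm_normalize_dist phi0.
  rewrite ler0_norm in dist; last lra.
  have := ler_normB (T i + `|phi|^-1 *: phi) (`|phi|^-1 *: phi - phi).
  rewrite opprB addrA addrAC addrK distrC dist.
  nra.
(* No error is allowed now, so each [T i] gets a whole sequence of vectors, with defects [w n]
   tending to 0. *)
pose w n : R := n.+1%:R^-1.
have /choice[y yP] : forall p : I * nat, exists y : Y,
    `|y| <= 1 /\ `|T p.1| - w p.2 < `|T p.1 y|.
  by move=> p; apply: bounded_op_norming; rewrite invr_gt0.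
have [] := HX Y YK
  ([set 0] `|` \bigcup_i range (fun n => T i (y (i, n)))).
  by apply: card_lt_countable_bigcup => // i; exact: card_image_le.
move=> phi phiP.
have phiE z : `|phi z| = `|z|.
  by have := phiP z 0 (or_introl erefl); rewrite normr0 !add0r.
have phi1 : `|phi| = 1.
  apply/eqP; rewrite eq_le; apply/andP; split.
    by apply: opnorm_leP => // z; rewrite phiE mul1r.
  by apply: bounded_op_norm_ge => // z; rewrite phiE mul1r.
exists phi; split=> // i; apply/eqP; rewrite eq_le; apply/andP; split.
  by rewrite (le_trans (ler_normD _ _))// phi1 (T1 i).
rewrite leNgt; apply/negP => lt2.
(* A norm below 2 would leave room for some [w n], against the lower bound 2(1 - [w n]). *)
have [] := @ltr_add_invr R (`|T i + phi| / 2) 1; first lra.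
move=> n; rewrite -/(w n) => wn.
have [y1 Ty] := yP (i, n); rewrite /= (T1 i) in Ty.
have : 1 * (2 * (1 - w n)) <= `|T i + phi|.
  apply: (bounded_opD_lower_bound (T1 i) y1) => //; first exact: ltW.
  by rewrite mul1r phiP//; right; exists i => //; exists n.
lra.
Qed.
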